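(* Let $(P,\cdot_P,\{-,-\}_P)$ be a coherent noncommutative Poisson algebra and $r\in P\otimes P$. Define $\Delta,\delta$ by $$\delta(x)=(1\otimes\mathrm{ad}_x+\mathrm{ad}_x\otimes1)r,\qquad\Delta(x)=(1\otimes L_x-R_x\otimes1)r,\qquad x\in P.$$ Then $(P,\Delta,\delta)$ is a noncommutative pseudo-Poisson bialgebra if and only if the following conditions are satisfied for all $x,y\in P$: (i) $(L_x\otimes1-1\otimes R_x)(1\otimes L_y-R_y\otimes1)(r+\tau(r))=0$; (ii) $(\mathrm{ad}_x\otimes1+1\otimes\mathrm{ad}_x)(r+\tau(r))=0$; (iii) $(\mathrm{ad}_x\otimes1)(1\otimes L_y-R_y\otimes1)(r+\tau(r))=0$; (iv) $(1\otimes1\otimes L_x-R_x\otimes1\otimes1)\mathbf A(r)=0$; (v) $(\mathrm{ad}_x\otimes1\otimes1+1\otimes\mathrm{ad}_x\otimes1+1\otimes1\otimes\mathrm{ad}_x)\mathbf C(r)=0$; (vi) for $r=\sum_ja_j\otimes b_j$, $$(\mathrm{ad}_x\otimes1\otimes1)\mathbf A(r)+(1\otimes1\otimes L_x-1\otimes R_x\otimes1)\mathbf C(r)+\sum_j\tau\Big((1\otimes\mathrm{ad}_{a_j})(1\otimes L_x-R_x\otimes1)(r+\tau(r))\Big)\otimes b_j=0.$$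
   Context: All vector spaces are finite dimensional over an algebraically closed field of characteristic $0$. A noncommutative Poisson algebra $(P,\cdot_P,\{-,-\}_P)$ is a vector space with an associative (not necessarily commutative) product $\cdot_P$ and a Lie bracket $\{-,-\}_P$ such that $\{x,y\cdot_Pz\}_P=\{x,y\}_P\cdot_Pz+y\cdot_P\{x,z\}_P$. It is coherent if $\{x,y\cdot_Pz\}_P+\{y,z\cdot_Px\}_P+\{z,x\cdot_Py\}_P=0$ for all $x,y,z$. Notation: $L_xy=x\cdot_Py$, $R_xy=y\cdot_Px$, $\mathrm{ad}_xy=\{x,y\}_P$, $\tau(x\otimes y)=y\otimes x$. For $r=\sum_ia_i\otimes b_i\in P\otimes P$, $$\mathbf A(r)=r_{12}\cdot r_{13}+r_{13}\cdot r_{23}-r_{23}\cdot r_{12}=\sum_{i,j}\big(a_i\cdot_Pa_j\otimes b_i\otimes b_j+a_i\otimes a_j\otimes b_i\cdot_Pb_j-a_j\otimes a_i\cdot_Pb_j\otimes b_i\big),$$ $$\mathbf C(r)=[r_{12},r_{13}]+[r_{12},r_{23}]+[r_{13},r_{23}]=\sum_{i,j}\big(\{a_i,a_j\}_P\otimes b_i\otimes b_j+a_i\otimes\{b_i,a_j\}_P\otimes b_j+a_i\otimes a_j\otimes\{b_i,b_j\}_P\big).$$ A noncommutative pseudo-Poisson bialgebra is a triple $((P,\cdot_P,\{-,-\}_P),\Delta,\delta)$ with $P$ a coherent noncommutative Poisson algebra and linear maps $\Delta:P\to P\otimes P$, $\delta:P\to\wedge^2P$ (where $\wedge^2P\subset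 P\otimes P$ denotes skew-symmetric tensors, so $\delta$ must take skew-symmetric values) such that (a) $P^*$ is a noncommutative Poisson algebra with product and bracket defined by $\langle\alpha\cdot_{P^*}\beta,x\rangle=\langle\Delta(x),\alpha\otimes\beta\rangle$ and $\langle\{\alpha,\beta\}_{P^*},x\rangle=\langle\delta(x),\alpha\otimes\beta\rangle$; (b) for all $x,y\in P$: $\Delta(x\cdot_Py)=(1\otimes L_x)\Delta(y)+(R_y\otimes1)\Delta(x)$; $\Delta(\{x,y\}_P)=(\mathrm{ad}_x\otimes1+1\otimes\mathrm{ad}_x)\Delta(y)-(1\otimes L_y)\delta(x)+(R_y\otimes1)\delta(x)$; $\delta(\{x,y\}_P)=(\mathrm{ad}_x\otimes1+1\otimes\mathrm{ad}_x)\delta(y)-(\mathrm{ad}_y\otimes1+1\otimes\mathrm{ad}_y)\delta(x)$; (c) for all $x,y\in P$: $(L_y\otimes1-1\otimes R_y)\Delta(x)+\tau\big((L_x\otimes1-1\otimes R_x)\Delta(y)\big)=0$; $(L_x\otimes1)\delta(y)+(R_y\otimes1)\delta(x)+(1\otimes\mathrm{ad}_x)\Delta(y)+(1\otimes\mathrm{ad}_y)\tau(\Delta(x))=\delta(x\cdot_Py)$. *)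

(* Defs.v *)
From HB Require Import structures.
From mathcomp Require Import all_boot all_order all_algebra.

Set Implicit Arguments.
Unset Strict Implicit.
Unset Printing Implicit Defensive.

Import GRing.Theory VectorInternalTheory.
Local Open Scope ring_scope.

Reserved Notation "u \ox v" (at level 40, left associativity).

Section Tensor.
Variable k : fieldType.

(* The tensor product is modelled on coordinate matrices with respect to the
   bases of U and V underlying their vectType structures.  The universal
   property (ox_bilinear, tlift_ox, tens_ext) shows that it does not depend
   on these bases. *)
Definition tens (U V : vectType k) : Type := 'M[k]_(dim U, dim V).

HB.instance Definition _ (U V : vectType k) :=
  Vector.copy (tens U V) 'M[k]_(dim U, dim V).

Definition ox (U V : vectType k) (u : U) (v : V) : tens U V :=
  (v2r u)^T *m v2r v.

Definition bilinear_map (U V W : lmodType k) (f : U -> V -> W) : Prop :=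
  (forall v, linear (f^~ v)) /\ (forall u, linear (f u)).

Definition std_basis (U : vectType k) (i : 'I_(dim U)) : U :=
  r2v (delta_mx 0 i).

(* For bilinear f this is the linear map with u (x) v |-> f u v; hence
   tlift f r stands for \sum_i f a_i b_i where r = \sum_i a_i (x) b_i
   (see tlift_sum). *)
Definition tlift (U V : vectType k) (W : lmodType k) (f : U -> V -> W)
    (t : tens U V) : W :=
  \sum_i \sum_j (t : 'M[k]_(_, _)) i j *: f (std_basis i) (std_basis j).

Definition tmap (U V U' V' : vectType k) (f : U -> U') (g : V -> V') :
    tens U V -> tens U' V' :=
  tlift (fun u v => ox (f u) (g v)).

Definition tswap (U V : vectType k) : tens U V -> tens V U :=
  tlift (fun u v => ox v u).

End Tensor.

Notation "u \ox v" := (ox u v) : ring_scope.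

Section TensorTheory.
Variable k : fieldType.
Implicit Types U V W : vectType k.

Lemma ox_bilinear U V : bilinear_map (@ox k U V).
Proof.
split=> [v|u] a x y; rewrite /ox linearP /=.
  by rewrite linearP /= mulmxDl scalemxAl.
by rewrite mulmxDr scalemxAr.
Qed.

Lemma std_basisE U (u : U) : u = \sum_i v2r u 0 i *: std_basis i.
Proof.
rewrite -[LHS]v2rK [v2r u in LHS]row_sum_delta linear_sum.
by apply: eq_bigr => i _; rewrite linearZ.
Qed.

Lemma tlift_linear U V (L : lmodType k) (f : U -> V -> L) : linear (tlift f).
Proof.
move=> a s t; rewrite /tlift scaler_sumr -big_split; apply: eq_bigr => i _ /=.
rewrite scaler_sumr -big_split; apply: eq_bigr => j _ /=.
by rewrite !mxE scalerDl scalerA.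
Qed.

HB.instance Definition _ U V (L : lmodType k) (f : U -> V -> L) :=
  GRing.isLinear.Build k (tens U V) L _ (tlift f) (tlift_linear f).

Lemma tlift_ox U V (L : lmodType k) (f : U -> V -> L) u v :
  bilinear_map f -> tlift f (u \ox v) = f u v.
Proof.
case=> fl fr.
have lin (A : vectType k) (h : A -> L) (x : A) : linear h ->
    h x = \sum_i v2r x 0 i *: h (std_basis i).
  move=> hl; pose hL := GRing.isLinear.Build k A L _ h hl.
  pose H : {linear A -> L} := HB.pack h hL.
  rewrite {1}[x]std_basisE -[h _]/(H _) linear_sum.
  by apply: eq_bigr => i _; rewrite linearZ.
rewrite (lin _ _ _ (fl v)) /tlift; apply: eq_bigr => i _.
rewrite (lin _ _ _ (fr _)) scaler_sumr; apply: eq_bigr => j _.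
by rewrite /ox !mxE big_ord1 !mxE scalerA.
Qed.

Lemma tlift_sum U V (L : lmodType k) (f : U -> V -> L) n
    (a : 'I_n -> U) (b : 'I_n -> V) :
  bilinear_map f -> tlift f (\sum_i a i \ox b i) = \sum_i f (a i) (b i).
Proof.
by move=> bf; rewrite linear_sum; apply: eq_bigr => i _; apply: tlift_ox.
Qed.

Lemma tens_basisE U V (t : tens U V) :
  t = tlift (@ox k U V) t.
Proof.
rewrite /tlift [LHS]matrix_sum_delta; apply: eq_bigr => i _.
apply: eq_bigr => j _; congr (_ *: _).
by rewrite /ox /std_basis !r2vK trmx_delta mul_delta_mx.
Qed.

Lemma tens_ext U V (L : lmodType k) (g h : {linear tens U V -> L}) :
  (forall u v, g (u \ox v) = h (u \ox v)) -> g =1 h.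
Proof.
move=> gh t; rewrite [t]tens_basisE /tlift !linear_sum.
apply: eq_bigr => i _; rewrite !linear_sum; apply: eq_bigr => j _.
by rewrite !linearZ gh.
Qed.

Lemma tens_decomp U V (t : tens U V) :
  exists n (a : 'I_n -> U) (b : 'I_n -> V), t = \sum_i a i \ox b i.
Proof.
exists (dim U), (@std_basis k U), (fun i => r2v (row i (t : 'M[k]_(_, _)))).
apply/row_matrixP => i; rewrite -[LHS]/(row i (t : 'M[k]_(_, _))).
apply/rowP => j; rewrite mxE [RHS]mxE.
rewrite summxE (bigD1 i) //= big1 ?addr0 => [|l nli];
  rewrite /ox /std_basis !r2vK !mxE big_ord1 !mxE ?eqxx ?mul1r //.
by rewrite eq_sym (negPf nli) andbF mul0r.
Qed.

Lemma eq_tlift U V (L : lmodType k) (f g : U -> V -> L) :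
  f =2 g -> tlift f =1 tlift g.
Proof.
by move=> fg t; apply: eq_bigr => i _; apply: eq_bigr => j _; rewrite fg.
Qed.

Lemma tmap_ox U V U' V' (f : {linear U -> U'}) (g : {linear V -> V'}) u v :
  tmap f g (u \ox v) = f u \ox g v.
Proof.
rewrite /tmap tlift_ox //; have [oxl oxr] := @ox_bilinear U' V'.
by split=> [w|w] a x y; rewrite linearP (oxl, oxr).
Qed.

Lemma tswap_ox U V (u : U) (v : V) : tswap (u \ox v) = v \ox u.
Proof.
rewrite /tswap tlift_ox //; have [oxl oxr] := @ox_bilinear V U.
by split=> [w|w] a x y; rewrite (oxl, oxr).
Qed.

Lemma tlift2_sum U V (L : lmodType k) (g : U -> V -> U -> V -> L) n
    (a : 'I_n -> U) (b : 'I_n -> V) :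
  (forall u v, bilinear_map (g u v)) ->
  (forall u v, bilinear_map (fun u' v' => g u' v' u v)) ->
  let r := \sum_i a i \ox b i in
  tlift (fun u v => tlift (g u v) r) r =
  \sum_i \sum_j g (a i) (b i) (a j) (b j).
Proof.
move=> bg2 bg1 /=; set r := \sum_i _.
have E u v : tlift (g u v) r = \sum_j g u v (a j) (b j) by rewrite tlift_sum.
rewrite (eq_tlift E) tlift_sum //; split=> [v|u] c x y;
  rewrite scaler_sumr -big_split; apply: eq_bigr => j _;
  by case: (bg1 (a j) (b j)) => gl gr; rewrite (gl, gr).
Qed.

Lemma scaler_comb3 (L : lmodType k) (c : k) (p q s p' q' s' : L) :
  (c *: p + p') + (c *: q + q') + (c *: s + s') =
  c *: (p + q + s) + (p' + q' + s').
Proof.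
by rewrite (addrACA (c *: p)) (addrACA (c *: p + c *: q)) !scalerDr.
Qed.

End TensorTheory.

Section NCPoisson.
Variables (k : fieldType) (P : vectType k).
Implicit Types mul br : P -> P -> P.

Record ncPoisson mul br : Prop := NCPoisson {
  ncp_mul_bilinear : bilinear_map mul;
  ncp_mulA : associative mul;
  ncp_br_bilinear : bilinear_map br;
  ncp_br_alt : forall x, br x x = 0;
  ncp_jacobi : forall x y z,
    br x (br y z) + br y (br z x) + br z (br x y) = 0;
  ncp_leibniz : forall x y z,
    br x (mul y z) = mul (br x y) z + mul y (br x z) }.

Definition coherent mul br : Prop := forall x y z,
  br x (mul y z) + br y (mul z x) + br z (mul x y) = 0.

End NCPoisson.

Section Bialgebra.
Variables (k : fieldType) (P : vectType k).
Variables mul br : P -> P -> P.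

Local Notation L x := (mul x).
Local Notation R x := (mul^~ x).
Local Notation ad x := (br x).
Local Notation P2 := (tens P P).
Local Notation P3 := (tens (tens P P) P).
Local Notation Pdual := 'Hom(P, k^o).

Definition tpair (t : P2) (alpha beta : Pdual) : k^o :=
  tlift (fun u v => alpha u * beta v : k^o) t.

(* linfun is only meaningful on linear maps: see dual_opE. *)
Definition dual_op (D : P -> P2) (alpha beta : Pdual) : Pdual :=
  linfun (fun x => tpair (D x) alpha beta).

Record nc_pseudo_Poisson_bialgebra (Delta delta : P -> P2) : Prop :=
  NCPseudoPoissonBialgebra {
  ncb_Poisson : ncPoisson mul br;
  ncb_coherent : coherent mul br;
  ncb_Delta_linear : linear Delta;
  ncb_delta_linear : linear delta;
  (* delta takes its values in the exterior square of P *)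
  ncb_delta_skew : forall x, tswap (delta x) = - delta x;
  ncb_dual : ncPoisson (dual_op Delta) (dual_op delta);
  ncb_Delta_mul : forall x y,
    Delta (mul x y) = tmap id (L x) (Delta y) + tmap (R y) id (Delta x);
  ncb_Delta_br : forall x y,
    Delta (br x y) = (tmap (ad x) id \+ tmap id (ad x)) (Delta y)
                     - tmap id (L y) (delta x) + tmap (R y) id (delta x);
  ncb_delta_br : forall x y,
    delta (br x y) = (tmap (ad x) id \+ tmap id (ad x)) (delta y)
                     - (tmap (ad y) id \+ tmap id (ad y)) (delta x);
  ncb_Delta_swap : forall x y,
    (tmap (L y) id \- tmap id (R y)) (Delta x)
    + tswap ((tmap (L x) id \- tmap id (R x)) (Delta y)) = 0;
  ncb_delta_mul : forall x y,
    tmap (L x) id (delta y) + tmap (R y) id (delta x)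
    + tmap id (ad x) (Delta y) + tmap id (ad y) (tswap (Delta x))
    = delta (mul x y) }.

Definition cobound_Delta (r : P2) (x : P) : P2 :=
  (tmap id (L x) \- tmap (R x) id) r.

Definition cobound_delta (r : P2) (x : P) : P2 :=
  (tmap id (ad x) \+ tmap (ad x) id) r.

Definition Atensor (r : P2) : P3 :=
  tlift (fun ai bi => tlift (fun aj bj =>
      mul ai aj \ox bi \ox bj + ai \ox aj \ox mul bi bj
      - aj \ox mul ai bj \ox bi) r) r.

Definition Ctensor (r : P2) : P3 :=
  tlift (fun ai bi => tlift (fun aj bj =>
      br ai aj \ox bi \ox bj + ai \ox br bi aj \ox bj
      + ai \ox aj \ox br bi bj) r) r.

Lemma AtensorE n (a b : 'I_n -> P) : bilinear_map mul ->
  Atensor (\sum_i a i \ox b i) = \sum_i \sum_j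
    (mul (a i) (a j) \ox b i \ox b j + a i \ox a j \ox mul (b i) (b j)
     - a j \ox mul (a i) (b j) \ox b i).
Proof.
case=> ml mr; have [ol orr] := @ox_bilinear k P P.
have [pl pr] := @ox_bilinear k (tens P P) P.
by rewrite /Atensor tlift2_sum // => u v; split=> [w|w] c x y;
  rewrite !(ml, mr) ?(ol, orr) ?(pl, pr) opprD -scalerN scaler_comb3.
Qed.

Lemma CtensorE n (a b : 'I_n -> P) : bilinear_map br ->
  Ctensor (\sum_i a i \ox b i) = \sum_i \sum_j
    (br (a i) (a j) \ox b i \ox b j + a i \ox br (b i) (a j) \ox b j
     + a i \ox a j \ox br (b i) (b j)).
Proof.
case=> ml mr; have [ol orr] := @ox_bilinear k P P.
have [pl pr] := @ox_bilinear k (tens P P) P.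
by rewrite /Ctensor tlift2_sum // => u v; split=> [w|w] c x y;
  rewrite !(ml, mr) ?(ol, orr) ?(pl, pr) scaler_comb3.
Qed.

Lemma dual_opE (D : P -> P2) (alpha beta : Pdual) x :
  linear D -> dual_op D alpha beta x = tpair (D x) alpha beta.
Proof.
move=> Dl; pose h y := tpair (D y) alpha beta.
have hl : linear h by move=> a y z; rewrite /h Dl /tpair linearP.
pose hL := GRing.isLinear.Build k P k^o _ h hl.
pose H : {linear P -> k^o} := HB.pack h hL.
by rewrite /dual_op -[fun y => _]/(H : P -> k^o) lfunE.
Qed.

End Bialgebra.

(* Main.v *)
Require Import Defs.
From HB Require Import structures.
From mathcomp Require Import all_boot all_order all_algebra ring.

Set Implicit Arguments.
Unset Strict Implicit.
Unset Printing Implicit Defensive.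

Import GRing.Theory VectorInternalTheory.
Local Open Scope ring_scope.

(** Writing [r] as the sum of the [a_i (x) b_i] and pairing with functionals
  turns every condition into an identity between sums of products of scalars.
  For a coboundary pair [(Delta, delta)], compatibility of [Delta] and of
  [delta] with [{x, y}] and of [Delta] with [x y] holds automatically; the
  remaining defects are, identically in [r]:
  - [tau delta + delta] is (ii), the first equation of (c) is (i), and the
    defect of the second one is [tau] applied to (iii);
  - the coassociativity defect is (iv);
  - the co-Leibniz defect is (vi), where coherence of [P] absorbs the terms
    that do not come from [A(r)] and [C(r)];
  - the co-Jacobi defect is (v) plus
    [\sum_j (ad_{a_j} (x) 1 (x) 1) (E (x) b_j)] with [E] the left side of (ii).
  Antisymmetry of [delta] makes the dual bracket alternating because
  [2 != 0]. *)

(** * Rewriting rules for unbundled linear and bilinear maps, and double sums *)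

Lemma linear_rules (k : fieldType) (U V : lmodType k) (f : U -> V) :
  linear f ->
  (forall u v, f (u + v) = f u + f v) * (forall u, f (- u) = - f u) * (f 0 = 0)
  * (forall c u, f (c *: u) = c *: f u).
Proof.
move=> fl; have fD u v : f (u + v) = f u + f v.
  by rewrite -[u]scale1r fl !scale1r.
have f0 : f 0 = 0 by apply: (addrI (f 0)); rewrite -fD !addr0.
split=> [|c u]; last by rewrite -[_ *: u]addr0 fl f0 addr0.
by split=> //; split=> // u; apply: (addrI (f u)); rewrite -fD !subrr.
Qed.

Lemma bilinear_rules (k : fieldType) (U V W : lmodType k) (f : U -> V -> W) :
  bilinear_map f ->
  (forall u u' v, f (u + u') v = f u v + f u' v)
  * (forall u v v', f u (v + v') = f u v + f u v')
  * (forall u v, f (- u) v = - f u v) * (forall u v, f u (- v) = - f u v)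
  * (forall c u v, f (c *: u) v = c *: f u v)
  * (forall c u v, f u (c *: v) = c *: f u v).
Proof.
by case=> l r; do !split=> *;
  rewrite ?(linear_rules (l _)) ?(linear_rules (r _)).
Qed.

(** [H] collects the terms whose summation indices have to be exchanged. *)
Lemma eq_double_sum (V : zmodType) n (F G H : 'I_n -> 'I_n -> V) :
  (forall i j, F i j + H j i = G i j + H i j) ->
  \sum_i \sum_j F i j = \sum_i \sum_j G i j.
Proof.
move=> FG; apply: (addIr (\sum_i \sum_j H i j)).
rewrite [\sum_i \sum_j H i j in LHS]exchange_big -!big_split /=.
apply: eq_bigr => i _; rewrite -!big_split /=.
by apply: eq_bigr => j _; rewrite FG.
Qed.

(** * Defect identities for a coboundary pair, in scalar form *)

Section Scalars.
Variables (k : fieldType) (P : vectType k) (mul br : P -> P -> P).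
Hypotheses (hP : ncPoisson mul br) (hcoh : coherent mul br).
Variables (n : nat) (a b : 'I_n -> P).
Implicit Types f g h : P -> k.

(** At [x], the dual product of [f] and [g]; the other [pair_] functions are likewise the pairings
    with [delta(x)], [A(r)], [C(r)] and [r + tau(r)]. Their arguments are bare functions, so that
    they can be nested and precomposed with [mul] and [br]. *)
Definition pair_Delta f g x : k :=
  \sum_i (f (a i) * g (mul x (b i)) - f (mul (a i) x) * g (b i)).

Definition pair_delta f g x : k :=
  \sum_i (f (a i) * g (br x (b i)) + f (br x (a i)) * g (b i)).

Definition pair_A f g h : k := \sum_i \sum_j
  (f (mul (a i) (a j)) * g (b i) * h (b j)
   + f (a i) * g (a j) * h (mul (b i) (b j))
   - f (a j) * g (mul (a i) (b j)) * h (b i)).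

Definition pair_C f g h : k := \sum_i \sum_j
  (f (br (a i) (a j)) * g (b i) * h (b j)
   + f (a i) * g (br (b i) (a j)) * h (b j)
   + f (a i) * g (a j) * h (br (b i) (b j))).

Definition pair_sym f g : k := \sum_i (f (a i) * g (b i) + f (b i) * g (a i)).

Let mulE := bilinear_rules (ncp_mul_bilinear hP).
Let brE := bilinear_rules (ncp_br_bilinear hP).

Lemma br_anti x y : br x y = - br y x.
Proof.
have := ncp_br_alt hP (x + y).
rewrite !brE !(ncp_br_alt hP) add0r addr0 addrC => /eqP.
by rewrite addr_eq0 => /eqP ->; rewrite opprK.
Qed.

Variables f g h : P -> k.
Hypotheses (fl : linear (f : P -> k^o)) (gl : linear (g : P -> k^o)).
Hypothesis hl : linear (h : P -> k^o).
Let fE := linear_rules fl. Let gE := linear_rules gl. Let hE := linear_rules hl.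

Lemma assoc_defect x :
  pair_Delta (pair_Delta f g) h x - pair_Delta f (pair_Delta g h) x
  = pair_A (fun u => f (mul u x)) g h - pair_A f g (fun u => h (mul x u)).
Proof.
rewrite /pair_Delta /pair_A -!sumrB.
under eq_bigr do rewrite !mulr_suml !mulr_sumr -!sumrB.
under [RHS]eq_bigr do rewrite -!sumrB.
(* The two summands differ by [H i j - H j i]: [H] lists one term of each pair that agrees only
   after [i] and [j] are interchanged. *)
pose H i j := f (mul (a i) (a j)) * g (b i) * h (mul x (b j))
  + f (a i) * g (mul (mul (a j) x) (b i)) * h (b j)
  - f (mul (mul (a i) (a j)) x) * g (b i) * h (b j)
  - f (mul (a i) x) * g (mul (a j) (b i)) * h (b j).
apply: (eq_double_sum (H := H)) => i j; rewrite /H !(ncp_mulA hP).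
ring.
Qed.

Lemma br_mull x y z : br (mul x y) z = mul (br x z) y + mul x (br y z).
Proof.
rewrite br_anti (ncp_leibniz hP) (br_anti z x) (br_anti z y).
by rewrite !mulE -opprD opprK.
Qed.

(** The Jacobi identity, oriented so that rewriting moves [x] innermost. *)
Lemma br_brr x y z : br x (br y z) = br (br x y) z - br (br x z) y.
Proof.
rewrite (br_anti (br x y)) (br_anti (br x z)) (br_anti x z) brE.
have /eqP := ncp_jacobi hP x y z.
by rewrite -addrA addr_eq0 => /eqP ->; rewrite !opprK opprD addrC.
Qed.

(** The left side is the Jacobi identity in derivation form. In the last sum, the two [pair_sym]
    terms together pair [f] composed with [ad_{a_i}], and [g], with the left side of (ii). *)
Lemma jacobi_defect x :
  pair_delta f (pair_delta g h) x - pair_delta g (pair_delta f h) x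
    - pair_delta (pair_delta f g) h x
  = pair_C (fun u => f (br x u)) g h + pair_C f (fun u => g (br x u)) h
    + pair_C f g (fun u => h (br x u))
    + \sum_i (pair_sym (fun u => f (br (a i) (br x u))) g
              + pair_sym (fun u => f (br (a i) u)) (fun u => g (br x u)))
             * h (b i).
Proof.
rewrite /pair_delta /pair_C /pair_sym -!sumrB -!big_split /=.
under eq_bigr do rewrite !mulr_suml !mulr_sumr -!big_split -!sumrB /=.
under [RHS]eq_bigr do rewrite -!big_split mulr_suml -!big_split /=.
pose H i j := - (f (a i) * g (br x (a j)) * h (br (b i) (b j)))
  + f (a i) * g (a j) * h (br (br x (b j)) (b i))
  - f (a i) * g (br (b i) (a j)) * h (br x (b j))
  - f (br (a i) (a j)) * g (b i) * h (br x (b j))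
  + f (a i) * g (br (br x (a j)) (b i)) * h (b j)
  - f (br (a i) (br x (b j))) * g (a j) * h (b i)
  - f (br (a i) (b j)) * g (br x (a j)) * h (b i)
  - f (br x (br (a i) (a j))) * g (b i) * h (b j)
  - f (br (a i) (a j)) * g (br x (b i)) * h (b j).
apply: (eq_double_sum (H := H)) => i j; rewrite /H.
(* Normal form for [ring]: nested brackets become [br (br x u) v], and the brackets of an [a] or [b]
   with another get a fixed order. *)
rewrite !(br_anti (a _) (br _ _)) !(br_brr x).
rewrite (br_anti (b j) (b i)) (br_anti (a j) (a i)).
rewrite (br_anti (a i) (b j)) (br_anti (a j) (b i)).
rewrite !fE !gE !hE.
ring.
Qed.

Lemma leibniz_defect x :
  pair_delta f (pair_Delta g h) x - pair_Delta (pair_delta f g) h x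
    - pair_Delta g (pair_delta f h) x
  = pair_A (fun u => f (br x u)) g h + pair_C f g (fun u => h (mul x u))
    - pair_C f (fun u => g (mul u x)) h
    + \sum_i (pair_sym g (fun u => f (br (a i) (mul x u)))
              - pair_sym (fun u => g (mul u x)) (fun u => f (br (a i) u)))
             * h (b i).
Proof.
rewrite /pair_delta /pair_Delta /pair_A /pair_C /pair_sym.
rewrite -!sumrB -!big_split -sumrB -big_split /=.
under eq_bigr do rewrite !mulr_suml !mulr_sumr -!sumrB -!big_split -!sumrB /=.
under [RHS]eq_bigr do
  rewrite -!sumrB -big_split -!sumrB mulr_suml -!big_split /=.
pose H i j := f (br x (a j)) * g (mul (a i) (b j)) * h (b i)
  - f (br (a i) (a j)) * g (b i) * h (mul x (b j))
  - f (a i) * g (br (b i) (a j)) * h (mul x (b j))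
  + f (a i) * g (a j) * h (br (mul x (b j)) (b i))
  + f (a i) * g (mul (a j) x) * h (br (b i) (b j))
  - f (a i) * g (br (mul (a j) x) (b i)) * h (b j)
  - f (br (a i) (mul x (b j))) * g (a j) * h (b i)
  + f (br (a i) (b j)) * g (mul (a j) x) * h (b i)
  + f (br (a i) (a j)) * g (mul (b i) x) * h (b j)
  - f (br x (mul (a i) (a j))) * g (b i) * h (b j).
(* Coherence is applied to [{x, a_i a_j}], the [ad_x] term of [A(r)]. It yields [{a_i, a_j x}],
   which comes from the dual bracket of [f] and [g] at [a_j x], and [{a_j, x a_i}], which comes from
   the correction sum. *)
have coh y z : br x (mul y z) = - br y (mul z x) - br z (mul x y).
  by apply/eqP; rewrite -subr_eq0 opprD !opprK addrA; apply/eqP.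
apply: (eq_double_sum (H := H)) => i j; rewrite /H.
rewrite !(coh (a _)) !br_mull !(ncp_leibniz hP).
rewrite (br_anti (b j) (b i)) (br_anti (a j) (a i)).
rewrite (br_anti (a i) (b j)) (br_anti (a j) (b i)).
rewrite ?(br_anti (a _) x) ?(br_anti (b _) x) ?mulE.
rewrite !fE !gE !hE.
ring.
Qed.

End Scalars.

(** * Separation of tensors by functionals, and bilinearity of the dual operations *)

Section Separation.
Variable k : fieldType.
Implicit Types U V : vectType k.

Lemma coordinate_functional V (j : 'I_(dim V)) :
  exists phi : 'Hom(V, k^o), forall v, phi v = v2r v 0 j.
Proof.
pose c (v : V) : k^o := v2r v 0 j.
have cl : linear c by move=> x u v; rewrite /c linearP !mxE.
pose C : {linear V -> k^o} := HB.pack c (GRing.isLinear.Build k V k^o _ c cl).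
by exists (linfun C) => v; rewrite lfunE.
Qed.

(** Coordinate functionals on the second factor recover the columns of [t]. Only that factor is
    contracted, so [U] may itself be a tensor product and the argument can be iterated. *)
Lemma tens_separated U V (t : tens U V) :
  (forall phi : 'Hom(V, k^o), tlift (fun u v => (phi v : k) *: u) t = 0) ->
  t = 0.
Proof.
move=> t0; apply/matrixP => i j; rewrite mxE.
have [phi phiE] := coordinate_functional j.
have E : r2v (row j (t : 'M[k]_(_, _))^T) = 0 :> U.
  rewrite -(t0 phi) [LHS]std_basisE r2vK /tlift; apply: eq_bigr => l _.
  rewrite (bigD1 j) //= big1 ?addr0 => [|m mj]; rewrite phiE r2vK !mxE ?eqxx.
    by rewrite scale1r.
  by rewrite eq_sym (negPf mj) andbF scale0r scaler0.
by have /(congr1 v2r) := E; rewrite r2vK linear0 => /rowP/(_ i); rewrite !mxE.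
Qed.

Lemma functional_separated V (v : V) :
  (forall phi : 'Hom(V, k^o), phi v = 0) -> v = 0.
Proof.
move=> v0; apply: (can_inj v2rK); rewrite linear0; apply/rowP => j.
by have [phi phiE] := coordinate_functional j; rewrite -phiE v0 mxE.
Qed.

Lemma linear_tlift U V (L M : lmodType k) (phi : L -> M)
    (F : U -> V -> L) t : linear phi ->
  phi (tlift F t) = tlift (fun u v => phi (F u v)) t.
Proof.
move=> phil; pose p := GRing.isLinear.Build k L M _ phi phil.
pose Phi : {linear L -> M} := HB.pack phi p.
rewrite -[phi]/(Phi : L -> M) /tlift linear_sum; apply: eq_bigr => i _.
by rewrite linear_sum; apply: eq_bigr => j _; rewrite linearZ.
Qed.

End Separation.

Lemma product_bilinear (k : fieldType) (U V : vectType k)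
    (f : U -> k) (g : V -> k) :
  linear (f : U -> k^o) -> linear (g : V -> k^o) ->
  bilinear_map (fun u v => f u * g v : k^o).
Proof.
move=> fl gl; split=> w c x y.
  by rewrite fl mulrDl; congr (_ + _); exact: esym (mulrA _ _ _).
by rewrite gl mulrDr; congr (_ + _); exact: mulrCA.
Qed.

(** Stated in [k] instead of [k^o], with scaling as multiplication, so that [ring] can use the
    result. *)
Lemma functionalE (k : fieldType) (V : vectType k) (f : 'Hom(V, k^o)) :
  (forall u v, f (u + v) = f u + f v :> k) * (forall u, f (- u) = - f u :> k)
  * (forall c u, f (c *: u) = c * f u :> k).
Proof.
have fE := linear_rules (linearP f : linear (f : V -> k^o)).
by do !split=> *; rewrite fE.
Qed.

Lemma tlift_linear_fun (k : fieldType) (U V : vectType k) (L : lmodType k)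
    (F G H : U -> V -> L) c t :
  (forall u v, F u v = c *: G u v + H u v) ->
  tlift F t = c *: tlift G t + tlift H t.
Proof.
move=> FE; rewrite /tlift scaler_sumr -big_split; apply: eq_bigr => i _ /=.
rewrite scaler_sumr -big_split; apply: eq_bigr => j _ /=.
by rewrite FE scalerDr !scalerA mulrC.
Qed.

Lemma dual_op_bilinear (k : fieldType) (P : vectType k) (D : P -> tens P P) :
  linear D -> bilinear_map (dual_op D).
Proof.
move=> Dl; split=> w c u v; apply/lfunP => x.
  rewrite add_lfunE scale_lfunE !dual_opE //; apply: tlift_linear_fun => y z.
  by rewrite add_lfunE scale_lfunE mulrDl scalerAl.
rewrite add_lfunE scale_lfunE !dual_opE //; apply: tlift_linear_fun => y z.
by rewrite add_lfunE scale_lfunE mulrDr scalerAr.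
Qed.

(** * Evaluation of functionals on tensors with two and three factors *)

Section Evaluation.
Variables (k : fieldType) (P : vectType k).
Implicit Types (f g h : P -> k) (t : tens P P) (T : tens (tens P P) P).

(** [tpair] for bare functions: operators acting on the tensor can then be moved onto [f] and
    [g]. *)
Definition ev2 f g t : k := @tlift k P P k^o (fun u v => f u * g v) t.

Definition ev3 f g h T : k :=
  @tlift k (tens P P) P k^o (fun t w => ev2 f g t * h w) T.

Lemma ev2_linear f g : linear (ev2 f g : tens P P -> k^o).
Proof. exact: tlift_linear. Qed.

Lemma ev3_linear f g h : linear (ev3 f g h : tens (tens P P) P -> k^o).
Proof. exact: tlift_linear. Qed.

Definition ev2E f g := linear_rules (@ev2_linear f g).
Definition ev3E f g h := linear_rules (@ev3_linear f g h).

Lemma ev2_separated s t :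
  (forall f g : 'Hom(P, k^o), ev2 f g s = ev2 f g t) -> s = t.
Proof.
move=> st; apply/eqP; rewrite -subr_eq0; apply/eqP; apply: tens_separated => g.
apply: functional_separated => f; rewrite linear_tlift; last exact: linearP.
transitivity (ev2 f g (s - t)).
  by apply: eq_tlift => u v; rewrite linearZ mulrC.
by rewrite !ev2E st subrr.
Qed.

Lemma ev3_separated T :
  (forall f g h : 'Hom(P, k^o), ev3 f g h T = 0) -> T = 0.
Proof.
move=> T0; apply: tens_separated => h; apply: ev2_separated => f g.
rewrite (linear_tlift _ _ (@ev2_linear f g)).
rewrite ev2E -(T0 f g h).
by apply: (@eq_tlift k _ _ k^o) => t w; rewrite ev2E mulrC.
Qed.

Lemma ev2_ox f g u v : linear (f : P -> k^o) -> linear (g : P -> k^o) ->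
  ev2 f g (u \ox v) = f u * g v.
Proof.
by move=> fl gl; rewrite /ev2 tlift_ox //; exact: product_bilinear.
Qed.

Lemma ev3_ox f g h t w : linear (h : P -> k^o) ->
  ev3 f g h (t \ox w) = ev2 f g t * h w.
Proof.
move=> hl; rewrite /ev3 tlift_ox //.
by apply: product_bilinear => //; exact: ev2_linear.
Qed.

Lemma ev2_tmap f g (p q : P -> P) t :
  linear (f : P -> k^o) -> linear (g : P -> k^o) ->
  ev2 f g (tmap p q t) = ev2 (fun u => f (p u)) (fun v => g (q v)) t.
Proof.
move=> fl gl; rewrite /tmap (linear_tlift _ _ (@ev2_linear f g)).
by apply: (@eq_tlift k _ _ k^o) => u v; apply: ev2_ox.
Qed.

Lemma ev2_tswap f g t : linear (f : P -> k^o) -> linear (g : P -> k^o) ->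
  ev2 f g (tswap t) = ev2 g f t.
Proof.
move=> fl gl; rewrite /tswap (linear_tlift _ _ (@ev2_linear f g)).
by apply: (@eq_tlift k _ _ k^o) => u v; rewrite ev2_ox // mulrC.
Qed.

Lemma ev3_tmap f g h (p q s : P -> P) T :
  linear (f : P -> k^o) -> linear (g : P -> k^o) -> linear (h : P -> k^o) ->
  ev3 f g h (tmap (tmap p q) s T)
  = ev3 (fun u => f (p u)) (fun u => g (q u)) (fun u => h (s u)) T.
Proof.
move=> fl gl hl; rewrite [tmap _ _ T]/tmap.
rewrite (linear_tlift _ _ (@ev3_linear f g h)).
by apply: (@eq_tlift k _ _ k^o) => u v; rewrite ev3_ox // ev2_tmap.
Qed.

Lemma ev2_sum f g n (a b : 'I_n -> P) :
  linear (f : P -> k^o) -> linear (g : P -> k^o) ->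
  ev2 f g (\sum_i a i \ox b i) = \sum_i f (a i) * g (b i).
Proof.
by move=> fl gl; rewrite /ev2 tlift_sum //; exact: product_bilinear.
Qed.

End Evaluation.

(** * Coboundary pairs: from scalar identities to tensor identities *)

Section Coboundary.
Variables (k : fieldType) (P : vectType k) (mul br : P -> P -> P).
Hypotheses (hP : ncPoisson mul br) (hcoh : coherent mul br).
Variables (n : nat) (a b : 'I_n -> P).
Let r : tens P P := \sum_i a i \ox b i.

Let ml := (ncp_mul_bilinear hP).1.
Let mr := (ncp_mul_bilinear hP).2.
Let bl := (ncp_br_bilinear hP).1.
Let brr := (ncp_br_bilinear hP).2.

Section Functionals.
Variables f g h : P -> k.
Hypotheses (fl : linear (f : P -> k^o)) (gl : linear (g : P -> k^o)).
Hypothesis hl : linear (h : P -> k^o).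

Ltac lin := by move=> ? ? ?; rewrite ?(ml, mr, bl, brr) ?(fl, gl, hl).

Lemma ev2_symmetrized : ev2 f g (r + tswap r) = pair_sym a b f g.
Proof.
rewrite ev2E ev2_tswap // !ev2_sum // -big_split /=.
by apply: eq_bigr => i _; rewrite [g _ * _]mulrC.
Qed.

Lemma ev2_cobound_Delta x :
  ev2 f g (cobound_Delta mul r x) = pair_Delta mul a b f g x.
Proof.
rewrite /cobound_Delta /= !ev2E !ev2_tmap // !ev2_sum //; try lin.
by rewrite -sumrB.
Qed.

Lemma ev2_cobound_delta x :
  ev2 f g (cobound_delta br r x) = pair_delta br a b f g x.
Proof.
rewrite /cobound_delta /= !ev2E !ev2_tmap // !ev2_sum //; try lin.
by rewrite -big_split.
Qed.

Lemma ev3_Atensor : ev3 f g h (Atensor mul r) = pair_A mul a b f g h.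
Proof.
rewrite AtensorE; last exact: ncp_mul_bilinear hP.
pose e := GRing.isLinear.Build k _ k^o _ _ (@ev3_linear k P f g h).
pose E : {linear tens (tens P P) P -> k^o} := HB.pack (ev3 f g h) e.
rewrite -[ev3 _ _ _]/(E : _ -> _) linear_sum; apply: eq_bigr => i _.
rewrite linear_sum; apply: eq_bigr => j _.
by rewrite linearB linearD /E /= !ev3_ox // !ev2_ox.
Qed.

Lemma ev3_Ctensor : ev3 f g h (Ctensor br r) = pair_C br a b f g h.
Proof.
rewrite CtensorE; last exact: ncp_br_bilinear hP.
pose e := GRing.isLinear.Build k _ k^o _ _ (@ev3_linear k P f g h).
pose E : {linear tens (tens P P) P -> k^o} := HB.pack (ev3 f g h) e.
rewrite -[ev3 _ _ _]/(E : _ -> _) linear_sum; apply: eq_bigr => i _.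
rewrite linear_sum; apply: eq_bigr => j _.
by rewrite !linearD /E /= !ev3_ox // !ev2_ox.
Qed.

End Functionals.

Implicit Types alpha beta gamma : 'Hom(P, k^o).

Ltac lin := let c := fresh in
  by move=> c ? ?; rewrite ?(ml _ c, mr _ c, bl _ c, brr _ c) linearP.

(** For identities linear in [r]: operators move onto the functionals, both sides become single
    sums, and only the [i]-th summands remain to be compared. *)
Ltac expand :=
  rewrite /cobound_Delta /cobound_delta /=;
  do ![rewrite !ev2E | rewrite ev2_tmap; [|lin|lin]
      | rewrite ev2_tswap; [|lin|lin]];
  rewrite ?ev2_sum; try lin;
  do ![rewrite -sumrN | rewrite scaler_sumr | rewrite -big_split /=];
  try apply: eq_bigr => i _.

Lemma cobound_Delta_linear : linear (cobound_Delta mul r).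
Proof.
move=> c x y; apply: ev2_separated => f g; expand.
rewrite !(bilinear_rules (ncp_mul_bilinear hP)) !functionalE.
by rewrite -[c *: (_ : k^o)]/(c * _); ring.
Qed.

Lemma cobound_delta_linear : linear (cobound_delta br r).
Proof.
move=> c x y; apply: ev2_separated => f g; expand.
rewrite !(bilinear_rules (ncp_br_bilinear hP)) !functionalE.
by rewrite -[c *: (_ : k^o)]/(c * _); ring.
Qed.

(** The mixed terms [(a_i y) (x) (x b_i)] cancel; the others match by associativity. *)
Lemma cobound_Delta_mul x y : cobound_Delta mul r (mul x y)
  = tmap id (mul x) (cobound_Delta mul r y)
    + tmap (mul^~ y) id (cobound_Delta mul r x).
Proof.
apply: ev2_separated => f g; expand.
by rewrite !(ncp_mulA hP); ring.
Qed.

(** By the Leibniz rule, [1 (x) L_{x,y} - R_{x,y} (x) 1] is the commutator of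
    [ad_x (x) 1 + 1 (x) ad_x] with [1 (x) L_y - R_y (x) 1]; the right side is this commutator
    applied to [r]. *)
Lemma cobound_Delta_br x y :
  cobound_Delta mul r (br x y)
  = (tmap (br x) id \+ tmap id (br x)) (cobound_Delta mul r y)
    - tmap id (mul y) (cobound_delta br r x)
    + tmap (mul^~ y) id (cobound_delta br r x).
Proof.
apply: ev2_separated => f g; expand.
by rewrite !(ncp_leibniz hP) !functionalE; ring.
Qed.

(** A 1-coboundary of the Lie algebra [P] with values in [P (x) P] is a 1-cocycle. *)
Lemma cobound_delta_br x y :
  cobound_delta br r (br x y)
  = (tmap (br x) id \+ tmap id (br x)) (cobound_delta br r y)
    - (tmap (br y) id \+ tmap id (br y)) (cobound_delta br r x).
Proof.
apply: ev2_separated => f g; expand.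
by rewrite !(br_brr hP x y) !(br_anti hP (br x _) y) !functionalE; ring.
Qed.

(** Left and right multiplications commute by associativity, so the swapped summand is the same
    composite of operators applied to [tau(r)]. *)
Lemma cobound_Delta_swap x y :
  (tmap (mul y) id \- tmap id (mul^~ y)) (cobound_Delta mul r x)
    + tswap ((tmap (mul x) id \- tmap id (mul^~ x)) (cobound_Delta mul r y))
  = (tmap (mul y) id \- tmap id (mul^~ y))
      ((tmap id (mul x) \- tmap (mul^~ x) id) (r + tswap r)).
Proof.
apply: ev2_separated => f g; expand.
by rewrite !(ncp_mulA hP); ring.
Qed.

Lemma cobound_delta_skew x :
  tswap (cobound_delta br r x) + cobound_delta br r x
  = (tmap (br x) id \+ tmap id (br x)) (r + tswap r).
Proof.
apply: ev2_separated => f g; expand.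
ring.
Qed.

Lemma cobound_delta_mul x y :
  tmap (mul x) id (cobound_delta br r y)
    + tmap (mul^~ y) id (cobound_delta br r x)
    + tmap id (br x) (cobound_Delta mul r y)
    + tmap id (br y) (tswap (cobound_Delta mul r x))
  = cobound_delta br r (mul x y)
    + tswap (tmap (br y) id
        ((tmap id (mul x) \- tmap (mul^~ x) id) (r + tswap r))).
Proof.
apply: ev2_separated => f g; expand.
(* On the second factor [ad_{xy}] is split by coherence, on the first by the Leibniz rule. *)
have -> : br (mul x y) (b i) = br x (mul y (b i)) + br y (mul (b i) x).
  by rewrite (br_anti hP) -[LHS]addr0 -(hcoh x y (b i)) addrC addrK.
rewrite (br_mull hP) !functionalE; ring.
Qed.

Lemma dual_DeltaE alpha beta :
  dual_op (cobound_Delta mul r) alpha beta =1 pair_Delta mul a b alpha beta.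
Proof.
move=> x; rewrite dual_opE; last exact: cobound_Delta_linear.
by apply: ev2_cobound_Delta; exact: linearP.
Qed.

Lemma dual_deltaE alpha beta :
  dual_op (cobound_delta br r) alpha beta =1 pair_delta br a b alpha beta.
Proof.
move=> x; rewrite dual_opE; last exact: cobound_delta_linear.
by apply: ev2_cobound_delta; exact: linearP.
Qed.

(** [dual_DeltaE] is a pointwise equality; this lets it rewrite the inner factor of a nested
    product. *)
Lemma eq_pair_Delta (f f' g g' : P -> k) :
  f =1 f' -> g =1 g' -> pair_Delta mul a b f g =1 pair_Delta mul a b f' g'.
Proof. by move=> ff gg x; apply: eq_bigr => i _; rewrite !ff !gg. Qed.

Lemma eq_pair_delta (f f' g g' : P -> k) :
  f =1 f' -> g =1 g' -> pair_delta br a b f g =1 pair_delta br a b f' g'.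
Proof. by move=> ff gg x; apply: eq_bigr => i _; rewrite !ff !gg. Qed.

Local Notation dmul := (dual_op (cobound_Delta mul r)).
Local Notation dbr := (dual_op (cobound_delta br r)).

Lemma ev3_associativity alpha beta gamma x :
  ev3 alpha beta gamma
    ((tmap (tmap id id) (mul x) \- tmap (tmap (mul^~ x) id) id) (Atensor mul r))
  = dmul alpha (dmul beta gamma) x
    - dmul (dmul alpha beta) gamma x :> k.
Proof.
rewrite !dual_DeltaE (eq_pair_Delta (frefl _) (dual_DeltaE _ _)).
rewrite (eq_pair_Delta (dual_DeltaE _ _) (frefl _)) -[RHS]opprB.
rewrite (assoc_defect hP); try exact: linearP.
rewrite opprB /= !ev3E !ev3_tmap; try exact: linearP.
by rewrite !ev3_Atensor //; lin.
Qed.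

Lemma ev3_leibniz alpha beta gamma x :
  ev3 alpha beta gamma
    (tmap (tmap (br x) id) id (Atensor mul r)
     + (tmap (tmap id id) (mul x) \- tmap (tmap id (mul^~ x)) id) (Ctensor br r)
     + tlift (fun a b =>
         tswap (tmap id (br a)
           ((tmap id (mul x) \- tmap (mul^~ x) id) (r + tswap r))) \ox b) r)
  = dbr alpha (dmul beta gamma) x
    - dmul (dbr alpha beta) gamma x
    - dmul beta (dbr alpha gamma) x :> k.
Proof.
rewrite !dual_DeltaE !dual_deltaE (eq_pair_delta (frefl _) (dual_DeltaE _ _)).
rewrite (eq_pair_Delta (dual_deltaE _ _) (frefl _)).
rewrite (eq_pair_Delta (frefl _) (dual_deltaE _ _)).
rewrite (leibniz_defect hP); try exact: linearP; try exact: hcoh.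
rewrite /= !ev3E !ev3_tmap; try exact: linearP.
rewrite ev3_Atensor ?ev3_Ctensor; try lin.
rewrite addrA; congr (_ + _).
set Y := tmap id (mul x) (r + tswap r) - _.
rewrite (linear_tlift _ _ (@ev3_linear k P alpha beta gamma)).
(* [G] is linear in [c], so the contraction with [r] can be expanded along the chosen
   [a_i (x) b_i]. *)
pose G c : k := ev2 beta (fun u => alpha (br c u)) Y.
transitivity (@tlift k P P k^o (fun c d => G c * gamma d) r).
  apply: (@eq_tlift k _ _ k^o) => c d; rewrite ev3_ox; last exact: linearP.
  by rewrite ev2_tswap ?ev2_tmap //; exact: linearP.
rewrite /r tlift_sum; last first.
  apply: product_bilinear; last exact: linearP.
  move=> c u v; apply: tlift_linear_fun => y z.
  by rewrite bl !functionalE mulrDr; congr (_ + _); exact: mulrCA.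
apply: eq_bigr => i _; congr (_ * _); rewrite /G /Y /= !ev2E !ev2_tmap; try lin.
by rewrite !ev2_symmetrized //; lin.
Qed.

Lemma ev3_jacobi alpha beta gamma x :
  (forall y, (tmap (br y) id \+ tmap id (br y)) (r + tswap r) = 0) ->
  ev3 alpha beta gamma
    ((tmap (tmap (br x) id) id \+ tmap (tmap id (br x)) id
      \+ tmap (tmap id id) (br x)) (Ctensor br r))
  = dbr alpha (dbr beta gamma) x
    - dbr beta (dbr alpha gamma) x
    - dbr (dbr alpha beta) gamma x :> k.
Proof.
move=> inv.
rewrite !dual_deltaE !(eq_pair_delta (frefl _) (dual_deltaE _ _)).
rewrite (eq_pair_delta (dual_deltaE _ _) (frefl _)).
rewrite (jacobi_defect hP); try exact: linearP.
rewrite /= !ev3E !ev3_tmap; try exact: linearP.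
rewrite !ev3_Ctensor; try lin.
rewrite [X in _ = _ + X]big1 ?addr0 // => i _.
have ev2D f g s t : ev2 f g (s + t) = ev2 f g s + ev2 f g t by rewrite ev2E.
(* The [i]-th correction is a multiple of (ii) paired with [alpha] composed with [ad_{a_i}], and
   [beta]. *)
have := congr1 (ev2 (fun u => alpha (br (a i) u)) beta) (inv x).
rewrite /= ev2D !ev2_tmap; try lin; rewrite [in RHS]ev2E.
rewrite !ev2_symmetrized; try lin.
by move=> ->; rewrite mul0r.
Qed.

End Coboundary.

(** * The equivalence, assembled from the defect identities *)

Theorem theorem4p2 (k : closedFieldType) (char0 : [pchar k] =i pred0)
    (P : vectType k) (mul br : P -> P -> P)
    (hP : ncPoisson mul br) (hcoh : coherent mul br) (r : tens P P) :
  nc_pseudo_Poisson_bialgebra mul br (cobound_Delta mul r) (cobound_delta br r)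
  <->
  (forall x y : P,
     (tmap (mul x) id \- tmap id (mul^~ x))
       ((tmap id (mul y) \- tmap (mul^~ y) id) (r + tswap r)) = 0
  /\ (tmap (br x) id \+ tmap id (br x)) (r + tswap r) = 0
  /\ tmap (br x) id
       ((tmap id (mul y) \- tmap (mul^~ y) id) (r + tswap r)) = 0
  /\ (tmap (tmap id id) (mul x) \- tmap (tmap (mul^~ x) id) id)
       (Atensor mul r) = 0
  /\ (tmap (tmap (br x) id) id \+ tmap (tmap id (br x)) id
      \+ tmap (tmap id id) (br x)) (Ctensor br r) = 0
  /\ tmap (tmap (br x) id) id (Atensor mul r)
     + (tmap (tmap id id) (mul x) \- tmap (tmap id (mul^~ x)) id)
         (Ctensor br r)
     + tlift (fun a b =>
         tswap (tmap id (br a)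
           ((tmap id (mul x) \- tmap (mul^~ x) id) (r + tswap r))) \ox b) r
     = 0).
Proof.
have [n [a [b ->]]] := tens_decomp r; set t := \sum_i _.
split=> [B x y|cond].
  (* Condition (ii) comes first, since [ev3_jacobi] relies on it to obtain (v). *)
  have inv z : (tmap (br z) id \+ tmap id (br z)) (t + tswap t) = 0.
    by rewrite -(cobound_delta_skew hP) (ncb_delta_skew B) addNr.
  have [_ dA _ _ _ dL] := ncb_dual B.
  split; first by rewrite -(cobound_Delta_swap hP) (ncb_Delta_swap B).
  split; first exact: inv.
  split.
    (* The defect at [(y, x)] is [tau] of (iii) at [(x, y)]; exchanging the functionals removes
       [tau]. *)
    have := ncb_delta_mul B y x; rewrite (cobound_delta_mul hP hcoh) => /eqP.
    rewrite -subr_eq0 addrC addKr => /eqP E.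
    apply: ev2_separated => f g; have := congr1 (ev2 g f) E.
    rewrite ev2_tswap; try exact: linearP.
    by move=> ->; rewrite !ev2E.
  split.
    by apply: ev3_separated => f g h; rewrite (ev3_associativity hP) dA subrr.
  split.
    apply: ev3_separated => f g h; rewrite (ev3_jacobi hP) //.
    (* The dual is itself an [ncPoisson] structure, so the bracket rules hold for functionals. *)
    rewrite (br_brr (ncb_dual B)) (br_anti (ncb_dual B) g (dual_op _ f h)).
    rewrite !add_lfunE !opp_lfunE.
    by rewrite opprK subrK subrr.
  apply: ev3_separated => f g h; rewrite (ev3_leibniz hP hcoh) dL add_lfunE.
  by rewrite addrAC addrK subrr.
have two : 2%:R != 0 :> k by rewrite (pcharf0P k).1.
(* Conditions involving a single element are read off at [y = x]. *)
have sym x y := (cond x y).1; have inv x := (cond x x).2.1.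
have mix x y := (cond x y).2.2.1; have A0 x := (cond x x).2.2.2.1.
have C0 x := (cond x x).2.2.2.2.1; have L0 x := (cond x x).2.2.2.2.2.
have skew x : tswap (cobound_delta br t x) = - cobound_delta br t x.
  by apply/eqP; rewrite -addr_eq0 (cobound_delta_skew hP) inv.
have Dl := cobound_Delta_linear hP a b; have dl := cobound_delta_linear hP a b.
have dskew f g :
    dual_op (cobound_delta br t) f g = - dual_op (cobound_delta br t) g f.
  apply/lfunP => x; rewrite opp_lfunE !dual_opE //.
  rewrite -[tpair _ f g]/(ev2 f g _) -[tpair _ g f]/(ev2 g f _).
  by rewrite -ev2_tswap ?skew ?ev2E //; exact: linearP.
split=> //.
- split.
  + exact: dual_op_bilinear.
  + move=> f g h; apply/lfunP => x; apply/eqP.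
    by rewrite -subr_eq0 -(ev3_associativity hP) A0 ev3E.
  + exact: dual_op_bilinear.
  + move=> f; have /eqP := dskew f f.
    by rewrite -addr_eq0 -mulr2n -scaler_nat scaler_eq0 (negPf two) => /eqP.
  + move=> f g h; apply/lfunP => x.
    have bil := dual_op_bilinear dl.
    (* Antisymmetry turns the cyclic sum into the derivation form of [ev3_jacobi]. *)
    rewrite (dskew h f) (dskew h (dual_op _ f g)) (linear_rules (bil.2 g)).
    have := ev3_jacobi hP f g h x inv; rewrite C0 ev3E => E.
    by rewrite !add_lfunE !opp_lfunE -E zero_lfunE.
  + move=> f g h; apply/lfunP => x; apply/eqP.
    rewrite -subr_eq0 add_lfunE opprD addrA -(ev3_leibniz hP hcoh).
    by rewrite L0 ev3E.
- exact: (cobound_Delta_mul hP).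
- exact: (cobound_Delta_br hP).
- exact: (cobound_delta_br hP).
- by move=> x y; rewrite (cobound_Delta_swap hP) sym.
- by move=> x y; rewrite (cobound_delta_mul hP hcoh) mix /tswap linear0 addr0.
Qed.
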